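(* Up to isomorphism, there is exactly one Steinitz-Rademacher polyhedron of cardinality 6, namely the structure $M_6$ with domain $\{v_0,v_1,e_0,e_1,f_0,f_1\}$, where $V=\{v_0,v_1\}$, $E=\{e_0,e_1\}$, $F=\{f_0,f_1\}$, and $I$ is the symmetric relation in which every vertex is incident with every edge and every face, every edge is incident with every face, and no other pairs are incident.
   Context: Let $\pi$ be the unsorted first-order signature with equality consisting of three unary predicates $V$ (''vertex''), $E$ (''edge''), $F$ (''face'') and one binary relation $I$ (''incidence''). The theory $\mathsf{SR}$ consists of the following $\pi$-sentences: (1) there is at least one vertex, at least one edge, and at least one face; (2) every element satisfies $V$, $E$, or $F$; (3) $I$ is symmetric; (4) no two vertices are incident with each other, no two edges are incident with each other, and no two faces are incident with each other; (5) for all $v,e,f$, if $V(v)$, $E(e)$, $F(f)$, $I(v,e)$ and $I(e,f)$, then $I(v,f)$; (6) every edge is incident with exactly two vertices; (7) every edge is incident with exactly two faces; (8) whenever $V(v)$, $F(f)$ and $I(v,f)$, there are exactly two edges incident with both $v$ and $f$; (9) every vertex and every face is incident with at least one other element. A Steinitz-Rademacher polyhedron is a $\pi$-structure satisfying all sentences of $\mathsf{SR}$; its cardinality is the cardinality of its domain. *)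

(* Defs.v *)
From mathcomp Require Import all_boot.

Set Implicit Arguments.
Unset Strict Implicit.
Unset Printing Implicit Defensive.

Record pi_structure : Type := PiStructure {
  dom :> Type;
  vertex : dom -> Prop;
  edge : dom -> Prop;
  face : dom -> Prop;
  inc : dom -> dom -> Prop
}.

Definition exactly_two (T : Type) (P : T -> Prop) : Prop :=
  exists x y : T, x <> y /\ forall z : T, P z <-> z = x \/ z = y.

(* As first-order sentences, the "no two ... are incident" axioms quantify over
   all pairs, including x = y. Disjointness of the three predicates is not an
   axiom. *)
Record SR (M : pi_structure) : Prop := {
  sr_ex_vertex : exists x : M, vertex x;
  sr_ex_edge : exists x : M, edge x;
  sr_ex_face : exists x : M, face x;
  sr_cover : forall x : M, vertex x \/ edge x \/ face x;
  sr_inc_sym : forall x y : M, inc x y -> inc y x;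
  sr_vertex_vertex : forall x y : M, vertex x -> vertex y -> ~ inc x y;
  sr_edge_edge : forall x y : M, edge x -> edge y -> ~ inc x y;
  sr_face_face : forall x y : M, face x -> face y -> ~ inc x y;
  sr_inc_trans : forall v e f : M,
    vertex v -> edge e -> face f -> inc v e -> inc e f -> inc v f;
  sr_edge_vertices : forall e : M,
    edge e -> exactly_two (fun v : M => vertex v /\ inc e v);
  sr_edge_faces : forall e : M,
    edge e -> exactly_two (fun f : M => face f /\ inc e f);
  sr_flag_edges : forall v f : M, vertex v -> face f -> inc v f ->
    exactly_two (fun e : M => edge e /\ inc e v /\ inc e f);
  sr_not_isolated : forall x : M,
    vertex x \/ face x -> exists y : M, y <> x /\ inc x y
}.

Definition has_cardinality (M : pi_structure) (n : nat) : Prop :=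
  exists f : M -> 'I_n, bijective f.

Definition isomorphic (M N : pi_structure) : Prop :=
  exists h : M -> N,
    [/\ bijective h,
        forall x : M, vertex x <-> vertex (h x),
        forall x : M, edge x <-> edge (h x),
        forall x : M, face x <-> face (h x)
      & forall x y : M, inc x y <-> inc (h x) (h y)].

Inductive m6_dom : Set := v0 | v1 | e0 | e1 | f0 | f1.

Definition m6_vertex (x : m6_dom) : Prop := x = v0 \/ x = v1.
Definition m6_edge (x : m6_dom) : Prop := x = e0 \/ x = e1.
Definition m6_face (x : m6_dom) : Prop := x = f0 \/ x = f1.

Definition m6_inc_up (x y : m6_dom) : Prop :=
  [\/ m6_vertex x /\ m6_edge y, m6_vertex x /\ m6_face y
    | m6_edge x /\ m6_face y].

Definition m6_inc (x y : m6_dom) : Prop := m6_inc_up x y \/ m6_inc_up y x.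

Definition M6 : pi_structure := PiStructure m6_vertex m6_edge m6_face m6_inc.

(* Main.v *)
Require Import Defs.
From mathcomp Require Import all_boot.
From Corelib Require Import Setoid.

Set Implicit Arguments.
Unset Strict Implicit.
Unset Printing Implicit Defensive.

(** The axioms force [vertex], [edge] and [face] to be pairwise disjoint. Any
    edge has two vertices and two faces, and a vertex-face flag on it has two
    edges; in a six-element polyhedron these are all the elements. Counting then
    leaves every edge no choice but both vertices and both faces, and vertices
    and faces are incident by transitivity through an edge. *)

(** Transporting [g] along the two enumerations gives an injective self-map of ['I_n], which is
    bijective by finiteness. *)
Lemma inj_card_bij (M N : pi_structure) (n : nat) (g : M -> N) :
  has_cardinality M n -> has_cardinality N n -> injective g -> bijective g.
Proof.
move=> [p [p' pK p'K]] [q [q' qK q'K]] g_inj.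
have [r rK Kr] : bijective (q \o g \o p').
  exact/injF_bij/inj_comp/can_inj/p'K/inj_comp/g_inj/can_inj/qK.
exists (p' \o r \o q) => x /=.
- by rewrite -{1}[x]pK; have /= -> := rK (p x).
- by apply: (can_inj qK); have /= -> := Kr (q x).
Qed.

Lemma isomorphic_sym (M N : pi_structure) : isomorphic M N -> isomorphic N M.
Proof.
case=> h [[k hK kK] hV hE hF hI]; exists k; split.
- by exists h.
- by move=> x; rewrite hV kK.
- by move=> x; rewrite hE kK.
- by move=> x; rewrite hF kK.
- by move=> x y; rewrite hI !kK.
Qed.

(** Pigeonhole: two distinct witnesses confined to [a] and [b] must use up both. *)
Lemma exactly_two_full (T : Type) (P : T -> Prop) (a b : T) :
  exactly_two P -> (forall z, P z -> z = a \/ z = b) -> P a /\ P b.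
Proof.
move=> [x [y [xDy Pxy]]] Pab.
have Px : P x by apply/Pxy; left.
have Py : P y by apply/Pxy; right.
by case: (Pab x Px) => ?; case: (Pab y Py) => ?; subst.
Qed.

Lemma exactly_twoP (T : Type) (P : T -> Prop) :
  exactly_two P -> exists x y : T, [/\ x <> y, P x & P y].
Proof.
by move=> [x [y [xDy Pxy]]]; exists x, y; split=> //; apply/Pxy; [left | right].
Qed.

Section Disjointness.

Variables (M : pi_structure) (srM : SR M).

Lemma vertex_edge_disj (x : M) : vertex x -> edge x -> False.
Proof.
move=> Vx Ex; have [v [_ [_ [Vv xv] _]]] := exactly_twoP (sr_edge_vertices srM Ex).
exact: (sr_vertex_vertex srM Vx Vv xv).
Qed.

Lemma edge_face_disj (x : M) : edge x -> face x -> False.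
Proof.
move=> Ex Fx; have [f [_ [_ [Ff xf] _]]] := exactly_twoP (sr_edge_faces srM Ex).
exact: (sr_face_face srM Fx Ff xf).
Qed.

(* Such an [x] could only be incident with edges, and transitivity through one
   of them would make [x] incident with itself. *)
Lemma vertex_face_disj (x : M) : vertex x -> face x -> False.
Proof.
move=> Vx Fx; have [y [_ xy]] := sr_not_isolated srM (or_introl Vx).
have [Vy|[Ey|Fy]] := sr_cover srM y.
- exact: (sr_vertex_vertex srM Vx Vy xy).
- apply: (sr_vertex_vertex srM Vx Vx).
  exact: (sr_inc_trans srM Vx Ey Fx xy (sr_inc_sym srM xy)).
- exact: (sr_face_face srM Fx Fy xy).
Qed.

End Disjointness.

(** Incidence in [M6] is the complete tripartite graph on the three sorts, so numbering the sorts
    reduces its axioms to equations in [nat]. *)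
Definition m6_sort (x : m6_dom) : nat :=
  match x with v0 | v1 => 0 | e0 | e1 => 1 | f0 | f1 => 2 end.

Lemma m6_vertexP (x : m6_dom) : m6_vertex x <-> m6_sort x = 0.
Proof. by rewrite /m6_vertex; case: x => /=; intuition congruence. Qed.

Lemma m6_edgeP (x : m6_dom) : m6_edge x <-> m6_sort x = 1.
Proof. by rewrite /m6_edge; case: x => /=; intuition congruence. Qed.

Lemma m6_faceP (x : m6_dom) : m6_face x <-> m6_sort x = 2.
Proof. by rewrite /m6_face; case: x => /=; intuition congruence. Qed.

Lemma m6_incP (x y : m6_dom) : m6_inc x y <-> m6_sort x <> m6_sort y.
Proof.
rewrite /m6_inc; split.
  by case=> -[] []; rewrite ?(m6_vertexP, m6_edgeP, m6_faceP) => -> ->.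
(* [m6_inc_up] always goes from a smaller sort to a larger one. *)
have up p q : m6_sort p < m6_sort q -> m6_inc_up p q.
  by case: p; case: q => //= _; solve
    [ apply: Or31; rewrite m6_vertexP m6_edgeP //
    | apply: Or32; rewrite m6_vertexP m6_faceP //
    | apply: Or33; rewrite m6_edgeP m6_faceP // ].
by move/eqP; rewrite neq_ltn => /orP[] /up; [left | right].
Qed.

Lemma M6_SR : SR M6.
Proof.
split=> /=.
- by exists v0; left.
- by exists e0; left.
- by exists f0; left.
- by move=> x; rewrite m6_vertexP m6_edgeP m6_faceP; case: x => /=; intuition.
- by move=> x y; rewrite !m6_incP => xDy /esym.
- by move=> x y; rewrite !m6_vertexP m6_incP => -> ->.
- by move=> x y; rewrite !m6_edgeP m6_incP => -> ->.
- by move=> x y; rewrite !m6_faceP m6_incP => -> ->.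
- by move=> v e f; rewrite m6_vertexP m6_edgeP m6_faceP !m6_incP => -> -> ->.
- move=> e; rewrite m6_edgeP => Ee; exists v0, v1; split=> // z.
  by rewrite m6_vertexP m6_incP Ee; case: z => /=; intuition congruence.
- move=> e; rewrite m6_edgeP => Ee; exists f0, f1; split=> // z.
  by rewrite m6_faceP m6_incP Ee; case: z => /=; intuition congruence.
- move=> v f; rewrite m6_vertexP m6_faceP => Vv Ff _; exists e0, e1; split=> // z.
  by rewrite m6_edgeP !m6_incP Vv Ff; case: z => /=; intuition congruence.
(* The case split is on the element: an edge contradicts [H], and every vertex or face is incident
   with [e0]. *)
- case=> H; solve [ by case: H; rewrite ?(m6_vertexP, m6_faceP)
                  | exists e0; split=> //; exact/m6_incP
                  | exists v0; split=> //; exact/m6_incP ].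
Qed.

Lemma M6_card : has_cardinality M6 6.
Proof.
pose s := [:: v0; v1; e0; e1; f0; f1].
pose k (x : m6_dom) : 'I_6 :=
  match x with
  | v0 => inord 0 | v1 => inord 1 | e0 => inord 2
  | e1 => inord 3 | f0 => inord 4 | f1 => inord 5
  end.
exists k; exists (fun i : 'I_6 => nth v0 s i) => [x|i].
- by case: x => /=; rewrite inordK.
- apply: val_inj; case: i => -[|[|[|[|[|[|//]]]]]] lt_i6 /=; exact: inordK.
Qed.

Definition m6_map (T : Type) (a b g h c d : T) (x : m6_dom) : T :=
  match x with v0 => a | v1 => b | e0 => g | e1 => h | f0 => c | f1 => d end.

Lemma SR_card6_isomorphic (M : pi_structure) :
  SR M -> has_cardinality M 6 -> isomorphic M M6.
Proof.
(* The map is built out of [M6], where it can be defined by cases on six constructors. *)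
move=> srM M6elts; apply: isomorphic_sym.
have VE := @vertex_edge_disj _ srM; have EF := @edge_face_disj M srM.
have VF := @vertex_face_disj M srM; have symM := sr_inc_sym srM.
have [e Ee] := sr_ex_edge srM.
have [a [b [aDb [Va ea] [Vb _]]]] := exactly_twoP (sr_edge_vertices srM Ee).
have [c [d [cDd [Fc ec] [Fd _]]]] := exactly_twoP (sr_edge_faces srM Ee).
have ac : inc a c by apply: (sr_inc_trans srM Va Ee Fc _ ec); exact: symM.
(* The flag of [a] and [c] is what guarantees a second edge. *)
have [g [h [gDh [Eg _] [Eh _]]]] := exactly_twoP (sr_flag_edges srM Va Fc ac).
pose m : M6 -> M := m6_map a b g h c d.
have mV x : m6_sort x = 0 -> vertex (m x) by case: x.
have mE x : m6_sort x = 1 -> edge (m x) by case: x.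
have mF x : m6_sort x = 2 -> face (m x) by case: x.
have sortV x : vertex (m x) -> m6_sort x = 0.
  by case: x => //= Vx; [case: (VE _ Vx) | case: (VE _ Vx) | case: (VF _ Vx) | case: (VF _ Vx)].
have sortE x : edge (m x) -> m6_sort x = 1.
  by case: x => //= Ex; [case: (VE _ _ Ex) | case: (VE _ _ Ex) | case: (EF _ Ex) | case: (EF _ Ex)].
have sortF x : face (m x) -> m6_sort x = 2.
  by case: x => //= Fx; [case: (VF _ _ Fx) | case: (VF _ _ Fx) | case: (EF _ _ Fx) | case: (EF _ _ Fx)].
have m_sort x y : m x = m y -> m6_sort x = m6_sort y.
  move=> mxy.
  have [s0|[s1|s2]] : m6_sort x = 0 \/ m6_sort x = 1 \/ m6_sort x = 2.
    by case: (x); auto.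
  - by rewrite s0 (sortV y) // -mxy; apply: mV.
  - by rewrite s1 (sortE y) // -mxy; apply: mE.
  - by rewrite s2 (sortF y) // -mxy; apply: mF.
(* Disjointness has reduced a collision to a single sort, where the two chosen elements are
   distinct. *)
have m_inj : injective m.
  move=> x y mxy; move: (m_sort _ _ mxy) (mxy); rewrite /m.
  by case: (x); case: (y) => //=; congruence.
(* Cardinality 6 enters here: [m] is onto, so the chosen elements exhaust [M]. *)
have [m' mK m'K] : bijective m by exact: (inj_card_bij M6_card M6elts m_inj).
have onlyV (z : M) : vertex z -> z = a \/ z = b.
  by rewrite -[z]m'K => /sortV; case: (m' z) => //=; [left | right].
have onlyF (z : M) : face z -> z = c \/ z = d.
  by rewrite -[z]m'K => /sortF; case: (m' z) => //=; [left | right].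
have edgeV (x v : M) : edge x -> vertex v -> inc x v.
  (* The two vertices of the edge [x] can only be [a] and [b], so both are incident with it. *)
  move=> Ex /onlyV; have only_xV z (xz : vertex z /\ inc x z) := onlyV z (proj1 xz).
  by have [[_ xa] [_ xb]] := exactly_two_full (sr_edge_vertices srM Ex) only_xV; case=> ->.
have edgeF (x f : M) : edge x -> face f -> inc x f.
  move=> Ex /onlyF; have only_xF z (xz : face z /\ inc x z) := onlyF z (proj1 xz).
  by have [[_ xc] [_ xd]] := exactly_two_full (sr_edge_faces srM Ex) only_xF; case=> ->.
have vertexF (v f : M) : vertex v -> face f -> inc v f.
  (* The one edge [e] is incident with every vertex and every face, so it links any such pair. *)
  move=> Vv Ff; apply: (sr_inc_trans srM Vv Ee Ff _ _); last exact: edgeF.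
  exact/symM/edgeV.
exists m; split=> [|x|x|x|x y] /=.
- by exists m'.
- by rewrite m6_vertexP; split=> [/mV|/sortV].
- by rewrite m6_edgeP; split=> [/mE|/sortE].
- by rewrite m6_faceP; split=> [/mF|/sortF].
(* Equal sorts are excluded by the three non-incidence axioms; distinct sorts follow from [edgeV],
   [edgeF], [vertexF] and symmetry. *)
rewrite m6_incP; split=> [|mxy xy]; last first.
  case: x xy mxy => /=; case: y => //= _;
    by [exact: (sr_vertex_vertex srM _ _) | exact: (sr_edge_edge srM _ _)
       | exact: (sr_face_face srM _ _)].
by case: x; case: y => //= _; auto.
Qed.

Theorem theorem5 :
  [/\ SR M6,
      has_cardinality M6 6
    & forall M : pi_structure, SR M -> has_cardinality M 6 -> isomorphic M M6].
Proof. split; [exact: M6_SR | exact: M6_card | exact: SR_card6_isomorphic]. Qed.
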